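(* Let $d_0$ and $d_1$ be nonempty bitstrings (finite words over $\{0,1\}$) of the same length. Let $S_f$ be the set of positive integers $n$ such that $f(m,d_0,d_1) < f(n,d_0,d_1)$ for all positive integers $m<n$. Then a positive integer $n$ belongs to $S_f$ if and only if the binary representation of $n$ is either an alternating sequence of $0$'s and $1$'s, or an alternating sequence of $0$'s and $1$'s in which exactly one of the $0$'s is replaced with $00$.
   Context: The binary representation of a positive integer $n$ is its usual base-2 expansion written with the most significant bit first and without leading zeros (so it starts with $1$). A run is a maximal block of consecutive equal bits. An alternating sequence of $0$'s and $1$'s is a bitstring in which no two adjacent bits are equal (the single-bit string $1$ is included). For bitstrings $d_0,d_1$ and a positive integer $n$, $f(n,d_0,d_1)$ is the integer represented in base 2 by the bitstring obtained from the binary representation of $n$ by appending $d_1$ immediately after (to the right of) each run of $1$'s and $d_0$ immediately after each run of $0$'s. Here the runs are those of the original binary representation of $n$. For example, $n=89$ has binary representation $1011001$, and $f(89,0,1)$ has binary representation $110011100011$, so $f(89,0,1)=3299$. *)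

(* Defs.v *)
(* Bitstrings are [seq bool] ([true] = 1, [false] = 0), most
   significant bit first. *)
From mathcomp Require Import all_boot.

Set Implicit Arguments.
Unset Strict Implicit.
Unset Printing Implicit Defensive.

Definition bval (s : seq bool) : nat := foldl (fun a (b : bool) => a.*2 + b) 0 s.

(* For n > 0, trunc_log 2 n is the index of the leading bit; binrep 0 is the
   junk value [:: false]. *)
Definition binrep (n : nat) : seq bool :=
  [seq odd (n %/ 2 ^ i) | i <- rev (iota 0 (trunc_log 2 n).+1)].

Lemma bval_rcons s b : bval (rcons s b) = (bval s).*2 + b.
Proof. by rewrite /bval foldl_rcons. Qed.

Lemma binrepD n : 1 < n -> binrep n = rcons (binrep n./2) (odd n).
Proof.
move=> n1; rewrite /binrep trunc_log2S //.
set k := (trunc_log 2 n./2).+1.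
have -> : iota 0 k.+1 = 0 :: map S (iota 0 k) by congr (_ :: _); exact: (iotaDl 1 0 k).
rewrite rev_cons map_rcons expn0 divn1 -map_rev -map_comp.
congr (rcons _ _); apply: eq_map => i /=.
by rewrite expnS divnMA divn2.
Qed.

Lemma binrepK n : bval (binrep n) = n.
Proof.
elim/ltn_ind: n => n IH; case: (ltnP 1 n) => [n1|]; last by case: n IH => [|[]].
have lt : n./2 < n by rewrite -divn2 ltn_Pdiv // ltnW.
by rewrite binrepD // bval_rcons (IH _ lt) addnC odd_double_half.
Qed.

Lemma head_binrep n : 0 < n -> head false (binrep n) = true.
Proof.
elim/ltn_ind: n => n IH n0; case: (ltnP 1 n) => [n1|]; last by case: n IH n0 => [|[]].
have lt : n./2 < n by rewrite -divn2 ltn_Pdiv.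
have n2 : 0 < n./2 by rewrite half_gt0.
by rewrite binrepD //; case: (binrep _) (IH _ lt n2).
Qed.

Fixpoint runs (s : seq bool) : seq (seq bool) :=
  if s is b :: s' then
    match runs s' with
    | (c :: r) :: rs =>
        if b == c then (b :: c :: r) :: rs else [:: b] :: (c :: r) :: rs
    | rs => [:: b] :: rs
    end
  else [::].

(* The next two lemmas say that [runs s] is the decomposition of [s] into
   maximal constant blocks. *)
Lemma flatten_runs s : flatten (runs s) = s.
Proof.
by elim: s => //= b s {2}<-; case: (runs s) => [|[|c r] rs] //=; case: ifP.
Qed.

Definition constant_block (r : seq bool) : bool := (r != [::]) && constant r.

Lemma runs_maximal s :
  all constant_block (runs s) /\
  sorted (fun r r' => head false r != head false r') (runs s).
Proof.
elim: s => [|b s [IHc IHs]] //=.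
case E: (runs s) IHc IHs => [|[|c r] rs] //= /andP[cr crs] prs.
have [->|bc] := eqVneq b c => /=; last by rewrite bc cr crs prs.
move: cr; rewrite /constant_block /= eqxx => ->; rewrite crs; split=> //.
by case: rs prs {E crs}.
Qed.

Definition insert_after_runs (d0 d1 s : seq bool) : seq bool :=
  flatten [seq r ++ (if head false r then d1 else d0) | r <- runs s].

Definition f (n : nat) (d0 d1 : seq bool) : nat :=
  bval (insert_after_runs d0 d1 (binrep n)).

Example f_89 : f 89 [:: false] [:: true] = 3299.
Proof. by vm_compute. Qed.

Definition S_f (d0 d1 : seq bool) (n : nat) : Prop :=
  0 < n /\ forall m, 0 < m -> m < n -> f m d0 d1 < f n d0 d1.

Definition alternating (s : seq bool) : bool :=
  sorted (fun a b : bool => a != b) s.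

Definition alternating_one_00 (s : seq bool) : Prop :=
  exists u v : seq bool,
    alternating (u ++ [:: false] ++ v) /\ s = u ++ [:: false; false] ++ v.

(* Main.v *)
Require Import Defs.
From mathcomp Require Import all_boot.
From mathcomp Require Import zify.

(** Let [L] be the common length of [d0] and [d1], and call two adjacent equal
    bits a repeat.  A string with [k] bits and [e] repeats has [k - e] runs, so
    its expansion has [k + L * (k - e)] bits ([size_insert]): length strongly
    rewards having few repeats, and expansions start with 1, so a longer one
    has a larger value.

    The comparisons that lengths do not settle follow from one fact
    ([insert_repeat0_lt]).  If two strings agree up to a bit 0, after which the
    first has 0 and the second has 1, then the expansions agree up to that bit
    0 and continue with [0 .. 0 d0 ..] and [d0 1 ..] respectively; and [0 d0]
    has a smaller value than [d0 1].  So the first expansion is smaller unless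
    it is longer.

    The strings of the theorem are those without the repeat 11 and with the
    repeat 00 at most once.  Let [s] be one of them, and let [t] represent a
    smaller number.  If [t] is shorter than [s], then so is its expansion.
    Otherwise [t] has 0 and [s] has 1 at the first place where they differ. The
    bit before that place is 0, since [s] does not contain 11, so [t] has at
    least one repeat, its expansion is no longer than that of [s], and the fact
    above applies ([few_repeats_record]).

    Conversely, cut any other string at its first repeat, [s = u b b v].  If
    [b = 1], the alternating string of the same length is smaller than [s] and
    has a longer expansion.  If [b = 0], there is a second repeat.  The
    alternating string with one bit less than [s] then has an expansion at
    least as long as that of [s], and by the fact above its value is larger
    ([record_shape]). *)

(** * Values of bitstrings *)

Lemma bval_cat s t : bval (s ++ t) = bval s * 2 ^ size t + bval t.
Proof.
elim/last_ind: t => [|t b IH]; first by rewrite cats0 muln1 addn0.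
by rewrite -rcons_cat !bval_rcons IH size_rcons expnS; lia.
Qed.

Lemma bval_cons b s : bval (b :: s) = b * 2 ^ size s + bval s.
Proof. by rewrite -cat1s bval_cat. Qed.

Lemma bval_ltn_exp s : bval s < 2 ^ size s.
Proof.
elim: s => // b s IH; rewrite bval_cons /= expnS.
by case: b; lia.
Qed.

Lemma bval_leading_one s : head false s -> 2 ^ (size s).-1 <= bval s.
Proof. by case: s => [|[] s] // _; rewrite bval_cons mul1n leq_addr. Qed.

Lemma bval_lt_size s t : head false t -> size s < size t -> bval s < bval t.
Proof.
move=> /bval_leading_one ht lt_st.
apply: leq_trans (bval_ltn_exp s) (leq_trans _ ht).
by rewrite leq_exp2l //; lia.
Qed.

Lemma bval_lt_cat2l p s t :
  size s <= size t -> bval s < bval t -> bval (p ++ s) < bval (p ++ t).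
Proof.
move=> le_st lt_st; rewrite !bval_cat.
have le2 : 2 ^ size s <= 2 ^ size t by rewrite leq_exp2l.
by have := leq_mul (leqnn (bval p)) le2; lia.
Qed.

Lemma bval_lt_first_difference s t : size s = size t -> bval s < bval t ->
  exists u x y, s = u ++ false :: x /\ t = u ++ true :: y.
Proof.
elim: s t => [|b s IH] [|c t] // [eq_st].
rewrite !bval_cons eq_st => lt_st.
have [eq_bc|] := eqVneq b c.
  have [|u [x [y [-> ->]]]] := IH t eq_st; first by move: lt_st; rewrite eq_bc; lia.
  by exists (b :: u), x, y; rewrite eq_bc.
case: b c lt_st => [] [] //= lt_st _; last by exists [::], s, t.
by have := bval_ltn_exp t; lia.
Qed.

Lemma bval_leading_one_inj s t :
  head false s -> head false t -> bval s = bval t -> s = t.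
Proof.
move=> hs ht eq_st.
have eq_size : size s = size t.
  case: (ltngtP (size s) (size t)) => // lt_size.
    by have := bval_lt_size s t ht lt_size; rewrite eq_st ltnn.
  by have := bval_lt_size t s hs lt_size; rewrite eq_st ltnn.
elim: s t eq_size eq_st {hs ht} => [|b s IH] [|c t] //= [eq_size].
rewrite !bval_cons eq_size => eq_st.
have lts := bval_ltn_exp s; have ltt := bval_ltn_exp t; rewrite eq_size in lts.
have eq_bc : b = c by case: b c eq_st => [] []; lia.
by rewrite eq_bc (IH t) //; move: eq_st; rewrite eq_bc; lia.
Qed.

Lemma bvalK s : head false s -> binrep (bval s) = s.
Proof.
move=> hs; apply: bval_leading_one_inj => //; last exact: binrepK.
apply: head_binrep; apply: leq_trans (bval_leading_one _ hs).
by rewrite expn_gt0.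
Qed.

(** * Repeats *)

Fixpoint repeats (b : bool) (s : seq bool) : nat :=
  if s is c :: s' then ((c == b) && (ohead s' == Some b)) + repeats b s' else 0.

Lemma repeats_cat b c u v :
  repeats b (u ++ c :: v) = repeats b (rcons u c) + repeats b (c :: v).
Proof.
elim: u => [|a u IH]; first by rewrite /= andbF.
rewrite [LHS]/= IH /= -/(repeats b (c :: v)) addnA.
by case: u {IH}.
Qed.

Lemma alternating_cons a b s :
  alternating [:: a, b & s] = (a != b) && alternating (b :: s).
Proof. by []. Qed.

Lemma alternatingE s : alternating s = (repeats true s + repeats false s == 0).
Proof.
elim: s => [|a [|b s] IH] //; first by rewrite /= !andbF.
by rewrite alternating_cons IH /= {IH}; case: a; case: b => /=; lia.
Qed.

Lemma alternating_cat u c v :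
  alternating (u ++ c :: v) = alternating (rcons u c) && alternating (c :: v).
Proof. by rewrite !alternatingE !repeats_cat; lia. Qed.

Lemma alternating_extend b m :
  exists w, size w = m /\ alternating (b :: w).
Proof.
elim: m b => [|m IH] b; first by exists [::].
have [w [<- alt_w]] := IH (~~ b).
exists (~~ b :: w); split=> //.
by rewrite alternating_cons alt_w; case: b {alt_w}.
Qed.

Lemma first_repeat s : ~~ alternating s ->
  exists u b v, s = u ++ [:: b, b & v] /\ alternating (rcons u b).
Proof.
elim: s => [|a [|b s] IH] //.
rewrite alternating_cons.
have [<- _|ab /= /IH [u [c [v [eq_s alt_u]]]]] := eqVneq a b.
  by exists [::], a, s.
exists (a :: u), c, v; rewrite eq_s; split=> //.
case: u eq_s alt_u => [|d u] [<- _] alt_u; rewrite /alternating /= ab //.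
Qed.

(** The strings of the theorem, in the form that matches the count of repeats
    in [size_insert]. *)
Lemma alternating_or_one_00_repeats s :
  alternating s \/ alternating_one_00 s ->
  repeats true s = 0 /\ repeats false s <= 1.
Proof.
case=> [|[u [v []]]]; first by rewrite alternatingE; lia.
rewrite /= alternatingE => alt_uv ->; move: alt_uv.
by rewrite !repeats_cat /=; lia.
Qed.

(** * Insertion after runs *)

Lemma insert_cons d0 d1 b s :
  insert_after_runs d0 d1 (b :: s) =
  b :: (if ohead s == Some b then [::] else if b then d1 else d0)
    ++ insert_after_runs d0 d1 s.
Proof.
rewrite /insert_after_runs.
case: s => [|c s]; first by rewrite /= cats0.
have [r [rs runs_s]] : exists r rs, runs (c :: s) = (c :: r) :: rs.
  rewrite /=; case: (runs s) => [|[|a r] rs]; try by eexists; eexists.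
  by case: eqP => _; eexists; eexists.
have -> : runs [:: b, c & s] =
    if b == c then (b :: c :: r) :: rs else [:: b] :: (c :: r) :: rs.
  by move: runs_s => /= ->.
rewrite runs_s /= (_ : (Some c == Some b) = (b == c)); last exact: eq_sym.
by case: eqP => [->|].
Qed.

Lemma head_insert d0 d1 s : head false (insert_after_runs d0 d1 s) = head false s.
Proof. by case: s => // b s; rewrite insert_cons. Qed.

Lemma size_insert d0 d1 s : size d0 = size d1 ->
  size (insert_after_runs d0 d1 s) + size d0 * (repeats true s + repeats false s)
  = size s * (size d0).+1.
Proof.
move=> eq_d; elim: s => [|b s IH]; first by rewrite /= muln0.
rewrite insert_cons /= size_cat.
case: b; case: s IH => [|[] s] /=; rewrite -?eq_d; lia.
Qed.

Lemma insert_prefix d0 d1 u b : exists p, forall w,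
  insert_after_runs d0 d1 (u ++ b :: w) = p ++ insert_after_runs d0 d1 (b :: w).
Proof.
elim: u => [|a u [p IH]]; first by exists [::].
exists (a :: (if ohead (rcons u b) == Some a then [::] else if a then d1 else d0) ++ p).
by move=> w; rewrite /= insert_cons IH catA; case: u {IH}.
Qed.

(** Leading zeros do not count, so the expansion of a string that starts with
    a run of zeros has the value of what follows that run; and the run is not
    empty, whence the strict inequality. *)
Lemma bval_insert0 d0 d1 s : exists X,
  bval (insert_after_runs d0 d1 (false :: s)) = bval (d0 ++ X) /\
  size (d0 ++ X) < size (insert_after_runs d0 d1 (false :: s)).
Proof.
elim: s => [|b s [X [eqX ltX]]]; first by exists [::]; rewrite insert_cons.
rewrite insert_cons bval_cons mul0n add0n.
case: b => /=; first by eexists.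
by exists X; split=> //; apply: leq_trans ltX _.
Qed.

(** With [delta] the value of [d0], the left side is below
    [(delta + 1) * 2 ^ size X], and the right side is at least
    [(2 * delta + 1) * 2 ^ size Y]. *)
Lemma bval_lt_zero_one d X Y :
  size X <= size Y -> bval (d ++ X) < bval (d ++ true :: Y).
Proof.
move=> le_XY; rewrite !bval_cat bval_cons /= expnS mul1n.
have lt_X := bval_ltn_exp X.
have le2 : 2 ^ size X <= 2 ^ size Y by rewrite leq_exp2l.
by have := leq_mul (leqnn (bval d)) le2; lia.
Qed.

(** Past the common part the expansions are [0 .. 0 d0 X] and [d0 1 Y], and
    dropping the zeros leaves [X] no longer than [Y]. *)
Lemma insert_repeat0_lt d0 d1 u x y :
  size (insert_after_runs d0 d1 (u ++ [:: false, false & x])) <=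
  size (insert_after_runs d0 d1 (u ++ [:: false, true & y])) ->
  bval (insert_after_runs d0 d1 (u ++ [:: false, false & x])) <
  bval (insert_after_runs d0 d1 (u ++ [:: false, true & y])).
Proof.
have [p eq_p] := insert_prefix d0 d1 u false.
rewrite !eq_p !size_cat leq_add2l => le_size.
apply: bval_lt_cat2l => //; move: le_size.
rewrite !(insert_cons _ _ false (_ :: _)) /= !(bval_cons false) !mul0n !add0n.
have [X [-> lt_X]] := bval_insert0 d0 d1 x.
rewrite (insert_cons _ _ true); move: (_ ++ insert_after_runs _ _ y) => Y le_size.
apply: bval_lt_zero_one.
by move: lt_X le_size; rewrite !size_cat /=; lia.
Qed.

(** * Records *)

Lemma S_f_bitstrings d0 d1 n : 0 < n ->
  S_f d0 d1 n <->
  forall t, head false t -> bval t < n ->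
    bval (insert_after_runs d0 d1 t) < bval (insert_after_runs d0 d1 (binrep n)).
Proof.
move=> n_gt0; split=> [[_ rec_n] t ht lt_tn|rec_n].
  rewrite -{1}(bvalK t ht); apply: rec_n => //.
  by apply: leq_trans (bval_leading_one _ ht); rewrite expn_gt0.
split=> // m m_gt0 lt_mn; apply: rec_n; first exact: head_binrep.
by rewrite binrepK.
Qed.

Lemma few_repeats_record d0 d1 s t : size d0 = size d1 ->
  repeats true s = 0 -> repeats false s <= 1 ->
  head false s -> head false t -> bval t < bval s ->
  bval (insert_after_runs d0 d1 t) < bval (insert_after_runs d0 d1 s).
Proof.
move=> eq_d no11 one00 hs ht lt_ts.
have size_s := size_insert d0 d1 s eq_d; have size_t := size_insert d0 d1 t eq_d.
have le_s := leq_mul (leqnn (size d0)) one00.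
have [lt_st|lt_ts'|eq_size] := ltngtP (size s) (size t).
- by have := bval_lt_size s t ht lt_st; lia.
- apply: bval_lt_size; first by rewrite head_insert.
  by have := leq_mul lt_ts' (leqnn (size d0).+1); lia.
have [u [x [y [eq_t eq_s]]]] := bval_lt_first_difference t s (esym eq_size) lt_ts.
have [u' eq_u] : exists u', u = rcons u' false.
  (* Both strings begin with 1, so the difference has a bit before it; a bit 1
     there would make a repeat 11 in [s]. *)
  case/lastP: u eq_t eq_s => [|u []] eq_t eq_s; last by exists u.
    by move: ht; rewrite eq_t.
  by move: no11; rewrite eq_s cat_rcons repeats_cat /=; lia.
rewrite eq_u !cat_rcons in eq_t eq_s.
have rep_t : 1 <= repeats false t by rewrite eq_t repeats_cat /=; lia.
rewrite eq_t eq_s; apply: insert_repeat0_lt; rewrite -eq_t -eq_s.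
have := leq_mul (leqnn (size d0)) rep_t.
by move: size_s; rewrite eq_size; lia.
Qed.

Lemma record_shape d0 d1 s : size d0 = size d1 -> 0 < size d0 ->
  head false s ->
  (forall t, head false t -> bval t < bval s ->
    bval (insert_after_runs d0 d1 t) < bval (insert_after_runs d0 d1 s)) ->
  alternating s \/ alternating_one_00 s.
Proof.
move=> eq_d d_gt0 hs rec_s.
have [|/first_repeat [u [b [v [eq_s alt_u]]]]] := boolP (alternating s); first by left.
right; have size_s := size_insert d0 d1 s eq_d.
have head_u w : head false (u ++ b :: w) by move: hs; rewrite eq_s; case: (u).
case: b => [|] in eq_s alt_u head_u *.
  have [w [size_w alt_w]] := alternating_extend true (size v).+1.
  case: w size_w alt_w => [|[] w] // [size_w] alt_w.
  have size_a := size_insert d0 d1 (u ++ [:: true, false & w]) eq_d.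
  have : alternating (u ++ [:: true, false & w]) by rewrite alternating_cat alt_u.
  rewrite alternatingE => /eqP rep_a; rewrite rep_a muln0 addn0 in size_a.
  have lt_as : bval (u ++ [:: true, false & w]) < bval s.
    rewrite eq_s; apply: bval_lt_cat2l; rewrite /= ?size_w // !bval_cons /=.
    by rewrite size_w; have := bval_ltn_exp w; rewrite size_w; lia.
  have lt_sa : bval (insert_after_runs d0 d1 s)
      < bval (insert_after_runs d0 d1 (u ++ [:: true, false & w])).
    apply: bval_lt_size; first by rewrite head_insert.
    have rep_s : 1 <= repeats true s by rewrite eq_s repeats_cat /=; lia.
    have := leq_mul (leqnn (size d0)) rep_s.
    by move: size_a size_s; rewrite eq_s !size_cat /= size_w; lia.
  by have := rec_s _ (head_u _) lt_as; lia.
exists u, v; split=> //; rewrite cat1s alternating_cat alt_u andTb.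
apply: contraT => nalt_v.
have [w [size_w alt_w]] := alternating_extend false (size v).
(* The second repeat lies in [0 v], so [v] is not empty and [w] has a first
   bit to compare with the second 0 of [s]. *)
case: w size_w alt_w => [|[] w] // size_w alt_w; first by case: (v) size_w nalt_v.
have size_a := size_insert d0 d1 (u ++ [:: false, true & w]) eq_d.
have : alternating (u ++ [:: false, true & w]) by rewrite alternating_cat alt_u.
rewrite alternatingE => /eqP rep_a; rewrite rep_a muln0 addn0 in size_a.
have lt_as : bval (u ++ [:: false, true & w]) < bval s.
  by apply: bval_lt_size => //; rewrite eq_s !size_cat /= -size_w /=; lia.
have := rec_s _ (head_u _) lt_as.
suff : bval (insert_after_runs d0 d1 s)
    < bval (insert_after_runs d0 d1 (u ++ [:: false, true & w])) by lia.
rewrite eq_s; apply: insert_repeat0_lt; rewrite -eq_s.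
have rep_s : 2 <= repeats true s + repeats false s.
  by move: nalt_v; rewrite alternatingE eq_s !repeats_cat /=; lia.
have := leq_mul (leqnn (size d0)) rep_s.
by move: size_a size_s; rewrite eq_s !size_cat /= -size_w /=; lia.
Qed.

Theorem theorem1 (d0 d1 : seq bool)
    (d0_nonempty : d0 <> [::]) (d1_nonempty : d1 <> [::])
    (same_length : size d0 = size d1) (n : nat) (n_gt0 : 0 < n) :
  S_f d0 d1 n <->
    alternating (binrep n) \/ alternating_one_00 (binrep n).
Proof.
have head_n := head_binrep n_gt0.
rewrite S_f_bitstrings // -{1}(binrepK n); split=> [|shape_n t ht lt_tn].
  by apply: record_shape => //; case: (d0) d0_nonempty.
have [no11 one00] := alternating_or_one_00_repeats _ shape_n.
exact: few_repeats_record.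
Qed.
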